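(* Let $A$ be a C*-algebra acting on a Hilbert space $H$, let $w(A)$ be the weak closure of $A$ in $B(H)$, and let $e$ be an Abelian projection in $w(A)$ such that $A\cap e\,w(A)\,e\neq\{0\}$. Then $\mathrm{Ann}(\mathrm{Ann}(A\cap e\,w(A)\,e))$ is an Abelian (commutative) C*-algebra.
   Context: For $S\subseteq A$, $\mathrm{Ann}(S)=\{a\in A: as+sa=0\ \forall s\in S\}$. A projection $e$ in a von Neumann algebra $M$ is Abelian if $eMe$ is commutative. *)

(* Defs.v *)
From mathcomp Require Import all_boot all_order all_algebra.
From mathcomp Require Import complex reals classical_sets.
Set Implicit Arguments. Unset Strict Implicit. Unset Printing Implicit Defensive.
Import Order.TTheory GRing.Theory Num.Theory.
Local Open Scope ring_scope.
Local Open Scope classical_set_scope.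

Definition is_inner_product (R : realType) (H : lmodType R[i])
  (ip : H -> H -> R[i]) : Prop :=
  [/\ (forall (a : R[i]) (x y z : H), ip (a *: x + y) z = a * ip x z + ip y z),
      (forall x y : H, ip y x = conjc (ip x y)),
      (forall x : H, 0 <= ip x x) &
      (forall x : H, ip x x = 0 -> x = 0)].

Definition hnorm (R : realType) (H : lmodType R[i]) (ip : H -> H -> R[i])
  (x : H) : R := Num.sqrt (complex.Re (ip x x)).

Definition ip_complete (R : realType) (H : lmodType R[i])
  (ip : H -> H -> R[i]) : Prop :=
  forall u : nat -> H,
    (forall e : R, 0 < e -> exists N : nat, forall m n : nat,
        (N <= m)%N -> (N <= n)%N -> hnorm ip (u m - u n) < e) ->
    exists l : H, forall e : R, 0 < e -> exists N : nat, forall n : nat,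
        (N <= n)%N -> hnorm ip (u n - l) < e.

Definition is_Hilbert (R : realType) (H : lmodType R[i])
  (ip : H -> H -> R[i]) : Prop :=
  is_inner_product ip /\ ip_complete ip.

Definition linear_op (R : realType) (H : lmodType R[i]) (T : H -> H) : Prop :=
  forall (a : R[i]) (x y : H), T (a *: x + y) = a *: T x + T y.

Definition bounded_op (R : realType) (H : lmodType R[i])
  (ip : H -> H -> R[i]) (T : H -> H) : Prop :=
  exists M : R, forall x : H, hnorm ip (T x) <= M * hnorm ip x.

Definition BH (R : realType) (H : lmodType R[i]) (ip : H -> H -> R[i])
  (T : H -> H) : Prop := linear_op T /\ bounded_op ip T.

Definition adjoint_of (R : realType) (H : lmodType R[i]) (ip : H -> H -> R[i])
  (T S : H -> H) : Prop := forall x y : H, ip (T x) y = ip x (S y).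

Definition op0 (R : realType) (H : lmodType R[i]) : H -> H := fun _ => 0.
Definition opadd (R : realType) (H : lmodType R[i]) (T S : H -> H) : H -> H :=
  fun x => T x + S x.
Definition opscale (R : realType) (H : lmodType R[i]) (a : R[i]) (T : H -> H)
  : H -> H := fun x => a *: T x.

(* A is a C*-subalgebra of B(H): a norm-closed *-subalgebra. Norm closedness
   is expressed with the operator norm: ||T - a|| <= e. *)
Definition is_Cstar_algebra (R : realType) (H : lmodType R[i])
  (ip : H -> H -> R[i]) (A : set (H -> H)) : Prop :=
  [/\ (forall T, A T -> BH ip T),
      A (@op0 R H),
      (forall T S, A T -> A S -> A (opadd T S)) &
   [/\
      (forall (a : R[i]) T, A T -> A (opscale a T)),
      (forall T S, A T -> A S -> A (T \o S)),
      (forall T, A T -> exists S, A S /\ adjoint_of ip T S) &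
      (forall T, BH ip T ->
         (forall e : R, 0 < e -> exists S, A S /\
             forall x : H, hnorm ip (T x - S x) <= e * hnorm ip x) ->
         A T)]].

(* weak (operator topology) closure w(A) of A in B(H): basic WOT
   neighbourhoods are given by finitely many pairs (x_i, y_i) and e > 0 *)
Definition weak_closure (R : realType) (H : lmodType R[i])
  (ip : H -> H -> R[i]) (A : set (H -> H)) : set (H -> H) :=
  fun T => BH ip T /\
    forall (s : seq (H * H)) (e : R), 0 < e ->
      exists S, A S /\ forall p, p \in s ->
        `| ip (T p.1 - S p.1) p.2 | < e%:C%C.

Definition is_projection_in (R : realType) (H : lmodType R[i])
  (ip : H -> H -> R[i]) (M : set (H -> H)) (e : H -> H) : Prop :=
  [/\ M e, e \o e = e & adjoint_of ip e e].

Definition corner (R : realType) (H : lmodType R[i]) (e : H -> H)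
  (M : set (H -> H)) : set (H -> H) :=
  fun T => exists S, M S /\ T = e \o S \o e.

Definition commutative_set (R : realType) (H : lmodType R[i])
  (M : set (H -> H)) : Prop :=
  forall T S, M T -> M S -> T \o S = S \o T.

Definition abelian_projection (R : realType) (H : lmodType R[i])
  (ip : H -> H -> R[i]) (M : set (H -> H)) (e : H -> H) : Prop :=
  is_projection_in ip M e /\ commutative_set (corner e M).

Definition Ann (R : realType) (H : lmodType R[i]) (A S : set (H -> H))
  : set (H -> H) :=
  fun a => A a /\ forall s, S s -> opadd (a \o s) (s \o a) = @op0 R H.

(* Main.v *)
(** Let [B = A `&` corner e w(A)]; since [e] is a projection, [B] consists of the
    [b] in [A] with [b = e b e].  For a set closed under products and adjoints the
    Jordan annihilator is the two-sided one: if [a] anticommutes with [s] and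
    [s^*] then it commutes with [s s^*], so [a s s^* = 0], hence
    [(a s) (a s)^* = 0] and [a s = 0].  Thus [C = Ann (Ann B)] is a C*-algebra in
    which [B] is essential: [B c = 0] puts [c c^*] in [C `&` Ann B = 0].  Finally
    the compressions [e x e] with [x] in [A] commute pairwise, so [B z B = 0] for
    [z = b x - x b], whence [C] commutes with [B], and then
    [b1 b2 (x y - y x) b3 = 0] for all [bi] in [B]. *)
Require Import Defs.
From mathcomp Require Import all_boot all_order all_algebra.
From mathcomp Require Import boolp complex reals classical_sets.
Set Implicit Arguments. Unset Strict Implicit. Unset Printing Implicit Defensive.
Import Order.TTheory GRing.Theory Num.Theory.
Local Open Scope ring_scope.
Local Open Scope classical_set_scope.

Section Operators.
Context (R : realType) (H : lmodType R[i]).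
Implicit Types (T S : H -> H).

Lemma linear_op0 T : linear_op T -> T 0 = 0.
Proof.
move=> lT; have := lT 1 0 0; rewrite !scale1r addr0 => h.
by apply: (addrI (T 0)); rewrite addr0 -h.
Qed.

Lemma linear_opD T x y : linear_op T -> T (x + y) = T x + T y.
Proof. by move=> lT; have := lT 1 x y; rewrite !scale1r. Qed.

Lemma linear_opZ T a x : linear_op T -> T (a *: x) = a *: T x.
Proof. by move=> lT; have := lT a x 0; rewrite (linear_op0 lT) !addr0. Qed.

Lemma linear_opN T x : linear_op T -> T (- x) = - T x.
Proof. by move=> lT; rewrite -(scaleN1r x) linear_opZ ?scaleN1r. Qed.

Lemma linear_opB T x y : linear_op T -> T (x - y) = T x - T y.
Proof. by move=> lT; rewrite linear_opD // linear_opN. Qed.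

Lemma addrr_eq0 (x : H) : x + x = 0 -> x = 0.
Proof.
rewrite -mulr2n -scaler_nat => /eqP; rewrite scaler_eq0.
by rewrite pnatr_eq0 /= => /eqP.
Qed.

End Operators.

(** * Inner products, adjoints and cancellation *)

Section InnerProduct.
Context (R : realType) (H : lmodType R[i]) (ip : H -> H -> R[i]).
Hypothesis ipP : is_inner_product ip.
Implicit Types (T S : H -> H).
Local Notation ann := (@Ann R H).

Lemma ip0l y : ip 0 y = 0.
Proof.
case: ipP => lin _ _ _; have := lin 1 0 0 y; rewrite scale1r addr0 mul1r => h.
by apply: (addrI (ip 0 y)); rewrite addr0 -h.
Qed.

Lemma ip0r y : ip y 0 = 0.
Proof. by case: ipP => _ sym _ _; rewrite sym ip0l conjc0. Qed.

Lemma ip_eq0 x : ip x x = 0 -> x = 0.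
Proof. by case: ipP => _ _ _; apply. Qed.

Lemma ip_injl u v : (forall y, ip u y = ip v y) -> u = v.
Proof.
move=> h; apply/eqP; rewrite -subr_eq0; apply/eqP/ip_eq0.
case: ipP => lin _ _ _.
by rewrite addrC -scaleN1r lin h mulN1r addNr.
Qed.

(** [hnorm] sees only the real part of [ip x x]; the order on [R[i]] makes the imaginary part of a
    nonnegative element vanish. *)
Lemma hnorm_eq0 x : hnorm ip x <= 0 -> x = 0.
Proof.
case: ipP => _ _ pos _; rewrite /hnorm => h; apply: ip_eq0.
have := pos x; case: (ip x x) h => a b /= h.
rewrite lecE /= => /andP[/eqP -> a_ge0].
have : Num.sqrt a == 0 by rewrite eq_le h sqrtr_ge0.
by rewrite sqrtr_eq0 => a_le0; congr Complex; apply/eqP; rewrite eq_le a_le0.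
Qed.

Lemma adjoint_sym T S : adjoint_of ip T S -> adjoint_of ip S T.
Proof. by case: ipP => _ sym _ _ h x y; rewrite sym -h -sym. Qed.

Lemma adjoint_comp T S T' S' :
  adjoint_of ip T T' -> adjoint_of ip S S' ->
  adjoint_of ip (T \o S) (S' \o T').
Proof. by move=> hT hS x y /=; rewrite hT hS. Qed.

Lemma adjoint_eq0 T S : adjoint_of ip T S -> (forall x, T x = 0) -> forall x, S x = 0.
Proof. by move=> h T0 x; apply: ip_eq0; rewrite -h T0 ip0l. Qed.

(** As [S] is the adjoint of [T], [ip (S x) (S x) = ip x (T (S x)) = 0], so [S] vanishes and with it
    its adjoint [T]. *)
Lemma mul_adjoint_eq0 T S :
  adjoint_of ip T S -> (forall x, T (S x) = 0) -> forall x, T x = 0.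
Proof.
move=> h TS0; apply: (adjoint_eq0 (adjoint_sym h)) => x.
apply: ip_eq0; rewrite (adjoint_sym h).
by rewrite TS0 ip0r.
Qed.

Definition star_closed (B : set (H -> H)) :=
  (forall T S, B T -> B S -> B (T \o S)) /\
  (forall T, B T -> exists S, B S /\ adjoint_of ip T S).

Lemma Cstar_star_closed B : is_Cstar_algebra ip B -> star_closed B.
Proof. by case=> _ _ _ []. Qed.

(** * Jordan annihilators of star-closed sets *)

Section Annihilator.
Context (A B : set (H -> H)).
Hypotheses (AP : is_Cstar_algebra ip A) (BA : B `<=` A) (BP : star_closed B).

Lemma Cstar_linear T : A T -> linear_op T.
Proof. by case: AP => h _ _ _ /h[]. Qed.

Lemma Ann_mul0 a s : ann A B a -> B s ->
  (forall x, a (s x) = 0) /\ (forall x, s (a x) = 0).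
Proof.
case: AP => _ _ _ [_ Amul Aadj _] [Aa aB] Bs.
have anti t x : B t -> a (t x) = - t (a x).
  move=> Bt; apply/eqP; rewrite -addr_eq0; apply/eqP.
  exact: (congr1 (@^~ x) (aB t Bt)).
have [t [Bt st]] := BP.2 s Bs.
have [a' [_ aa']] := Aadj a Aa.
have la := Cstar_linear Aa; have ls := Cstar_linear (BA Bs).
have as0 : forall x, a (s x) = 0.
  apply: (mul_adjoint_eq0 (adjoint_comp aa' st)) => x /=.
  (* Moving [a] past [s \o t] at once costs one sign, past [s] and then [t] two; the two values of
     the same vector cancel. *)
  apply: addrr_eq0.
  have := anti _ (a' x) (BP.1 _ _ Bs Bt); rewrite /= => {1}->.
  by rewrite (anti s) // (anti t) // (linear_opN _ ls) opprK addNr.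
split=> // x; have := anti s x Bs; rewrite as0 => /esym/eqP.
by rewrite oppr_eq0 => /eqP.
Qed.

Lemma AnnP a : A a ->
  (forall s, B s ->
    (forall x, a (s x) = 0) /\ (forall x, s (a x) = 0)) -> ann A B a.
Proof.
move=> Aa h; split=> // s /h[as0 sa0]; apply/funext => x.
by rewrite /opadd /= as0 sa0 addr0.
Qed.

(** By [Ann_mul0] and [AnnP], membership means [a s = s a = 0] on [B], a condition that passes to
    products, to adjoints because [B] is star-closed, and to norm limits because each [s] is
    bounded. *)
Lemma Ann_Cstar : is_Cstar_algebra ip (ann A B).
Proof.
have [Ab A0 Aadd [Asc Amul Aadj Acl]] := AP.
have Blin s : B s -> linear_op s by move=> /BA /Cstar_linear.
split.
- by move=> T [/Ab].
- by apply: AnnP => // s Bs; split=> x //=; rewrite /op0 linear_op0 //; exact: Blin.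
- move=> T S hT hS; apply: AnnP; first exact: Aadd hT.1 hS.1.
  move=> s Bs; have [T1 T2] := Ann_mul0 hT Bs.
  have [S1 S2] := Ann_mul0 hS Bs; split=> x /=; rewrite /opadd.
    by rewrite T1 S1 addr0.
  by rewrite linear_opD ?T2 ?S2 ?addr0 //; exact: Blin.
split.
- move=> a T hT; apply: AnnP; first exact: Asc hT.1.
  move=> s Bs; have [T1 T2] := Ann_mul0 hT Bs; split=> x /=; rewrite /opscale.
    by rewrite T1 scaler0.
  by rewrite linear_opZ ?T2 ?scaler0 //; exact: Blin.
- move=> T S hT hS; apply: AnnP; first exact: Amul hT.1 hS.1.
  move=> s Bs; have [T1 T2] := Ann_mul0 hT Bs.
  have [S1 S2] := Ann_mul0 hS Bs; split=> x /=.
    by rewrite S1 /op0 linear_op0 //; exact: Cstar_linear hT.1.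
  exact: T2.
- move=> T hT; have [S [AS TS]] := Aadj T hT.1; exists S; split=> //.
  apply: AnnP => // s Bs; have [t [Bt st]] := BP.2 s Bs.
  have [T1 T2] := Ann_mul0 hT Bt; split.
    exact: adjoint_eq0 (adjoint_comp (adjoint_sym st) TS) T2.
  exact: adjoint_eq0 (adjoint_comp TS (adjoint_sym st)) T1.
- move=> T bT h; apply: AnnP.
    by apply: Acl => // r /h[S [[AS _] hS]]; exists S.
  move=> s Bs; split=> x /=; apply: hnorm_eq0.
    apply/ler_addgt0Pl => r r0; rewrite addr0.
    have n0 : 0 < hnorm ip (s x) + 1 by rewrite ltr_wpDl ?sqrtr_ge0.
    have [S [hS hTS]] := h (r / (hnorm ip (s x) + 1)) (divr_gt0 r0 n0).
    have := hTS (s x); have [-> _] := Ann_mul0 hS Bs.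
    rewrite subr0 => /le_trans; apply.
    rewrite mulrAC ler_pdivrMr // ler_pM2l // lerDl ler01 //.
  have [ls [M hM]] := Ab s (BA Bs).
  apply/ler_addgt0Pl => r r0; rewrite addr0.
  (* The bound [M] may be negative, hence its absolute value; the added 1 keeps the divisor
     positive. *)
  set K := `|M| * hnorm ip x + 1.
  have K0 : 0 < K by rewrite ltr_wpDl ?mulr_ge0 ?sqrtr_ge0.
  have [S [hS hTS]] := h (r / K) (divr_gt0 r0 K0).
  have -> : s (T x) = s (T x - S x).
    have [_ S2] := Ann_mul0 hS Bs.
    by rewrite linear_opB // S2 subr0.
  apply: (le_trans (hM _)); apply: (@le_trans _ _ (`|M| * (r / K * hnorm ip x))).
    apply: (@le_trans _ _ (`|M| * hnorm ip (T x - S x))).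
      by rewrite ler_wpM2r ?sqrtr_ge0 ?ler_norm.
    by rewrite ler_wpM2l.
  rewrite mulrCA mulrAC ler_pdivrMr // ler_pM2l // lerDl ler01 //.
Qed.

End Annihilator.

Lemma sub_Ann_Ann A B : B `<=` A -> B `<=` ann A (ann A B).
Proof.
move=> BA s Bs; split; first exact: BA.
by move=> a [_ aB]; rewrite -(aB s Bs); apply/funext => x; rewrite /opadd addrC.
Qed.

(** * The double annihilator and essentiality of [B] *)

Section DoubleAnnihilator.
Context (A B : set (H -> H)).
Hypotheses (AP : is_Cstar_algebra ip A) (BA : B `<=` A) (BP : star_closed B).
Let C := ann A (ann A B).

Let annBP : star_closed (ann A B).
Proof. exact/Cstar_star_closed/Ann_Cstar. Qed.

Lemma Ann_Ann_Cstar : is_Cstar_algebra ip C.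
Proof. by apply: Ann_Cstar => // T []. Qed.

Let CP : star_closed C.
Proof. exact/Cstar_star_closed/Ann_Ann_Cstar. Qed.

Lemma essential_left c : C c ->
  (forall b x, B b -> b (c x) = 0) -> forall x, c x = 0.
Proof.
move=> Cc Bc0; have [c' [Cc' cc']] := CP.2 c Cc.
have Ccc : C (c \o c') := CP.1 _ _ Cc Cc'.
have sa : adjoint_of ip (c \o c') (c \o c').
  exact: adjoint_comp cc' (adjoint_sym cc').
(* Since [c \o c'] is self-adjoint, it is enough that its square vanishes; it does, as one factor is
   read in [C] and the other in [ann A B]. *)
apply: (mul_adjoint_eq0 cc'); apply: (mul_adjoint_eq0 sa).
have hann : ann A B (c \o c').
  apply: AnnP => [|s Bs]; first exact: Ccc.1.
  have left0 b x : B b -> b (c (c' x)) = 0 by exact: Bc0.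
  split=> [|x]; last exact: left0.
  have [t [Bt st]] := BP.2 s Bs.
  exact: adjoint_eq0 (adjoint_comp (adjoint_sym st) sa) (fun x => left0 t x Bt).
by have [] := Ann_mul0 AP (fun T (h : ann A B T) => h.1) annBP Ccc hann.
Qed.

(** Essentiality on the left, applied to [c t] with [t] in [B], gives [c t = 0]; adjoints turn this
    into [b c' = 0] for all [b] in [B], and a second application kills [c']. *)
Lemma essential_two_sided c : C c ->
  (forall b b' x, B b -> B b' -> b (c (b' x)) = 0) -> forall x, c x = 0.
Proof.
move=> Cc BcB0; have [c' [Cc' cc']] := CP.2 c Cc.
apply: (adjoint_eq0 (adjoint_sym cc')); apply: essential_left => // b x Bb; move: x.
have [t [Bt bt]] := BP.2 b Bb.
apply: (adjoint_eq0 (adjoint_comp cc' (adjoint_sym bt))).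
apply: essential_left => [|b' x Bb']; last exact: (BcB0 b' t x).
exact: CP.1 Cc (sub_Ann_Ann BA Bt).
Qed.

(** * Commutativity from commuting compressions *)

Section Commutative.
Context (e : H -> H).
Hypotheses
  (compressions_commute : forall T S, A T -> A S ->
     (e \o T \o e) \o (e \o S \o e) =1 (e \o S \o e) \o (e \o T \o e))
  (eK : forall x, e (e x) = e x)
  (eB : forall x b, B b -> e (b x) = b x)
  (Be : forall x b, B b -> b (e x) = b x).

Let lin T : A T -> linear_op T.
Proof. exact: Cstar_linear. Qed.

Let commutator_mem T S : C T -> C S -> C (opadd (T \o S) (opscale (-1) (S \o T))).
Proof.
by case: Ann_Ann_Cstar => _ _ Cadd [Csc Cmul _ _] CT CS; auto.
Qed.

(* [e] need not lie in [A], but [b T b' = b (e T e) b'] is in the compression. *)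
Let mid_commute b T b' x : B b -> A T -> B b' ->
  b (T (b' x)) = e (T (b (b' x))).
Proof.
move=> Bb AT Bb'; have := compressions_commute (BA Bb) AT (b' x).
by rewrite /= !(eB _ Bb, eB _ Bb', Be _ Bb).
Qed.

Lemma Ann_Ann_commute_base b c : B b -> C c -> b \o c =1 c \o b.
Proof.
move=> Bb Cc x; have Cb := sub_Ann_Ann BA Bb.
apply/eqP; rewrite -subr_eq0; apply/eqP.
have := @essential_two_sided _ (commutator_mem Cb Cc).
rewrite /opadd /opscale /=; move=> /(_ _ x); rewrite scaleN1r; apply.
move=> b1 b2 y B1 B2.
rewrite scaleN1r linear_opB; last exact/lin/BA.
(* Absorbing [b] into the left factor [b1] here, and into the right factor [b2] below, gives both
   terms the same value. *)
have -> : b1 (b (c (b2 y))) = e (c (b1 (b (b2 y)))).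
  exact: (@mid_commute (b1 \o b) c b2 y (BP.1 _ _ B1 Bb) Cc.1 B2).
have -> : b1 (c (b (b2 y))) = e (c (b1 (b (b2 y)))).
  exact: (@mid_commute b1 c (b \o b2) y B1 Cc.1 (BP.1 _ _ Bb B2)).
exact: subrr.
Qed.

Lemma Ann_Ann_commutative : commutative_set C.
Proof.
move=> T S CT CS; apply/funext => x.
apply/eqP; rewrite -subr_eq0; apply/eqP.
have Cd := commutator_mem CT CS.
have := @essential_two_sided _ Cd _ x.
rewrite {2}/opadd {2}/opscale scaleN1r; apply=> b2 b3 z B2 B3.
(* The third factor [b1] supplies, through [b1 = b1 e], the outer [e] that completes the compression
   of [U] in [swap]. *)
apply: (@essential_left (b2 \o _ \o b3) _ _ z) => [|b1 y B1 /=].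
  by apply: CP.1; [apply: CP.1 => // |]; exact: sub_Ann_Ann.
rewrite /opadd /opscale scaleN1r /=.
rewrite !linear_opB; [|exact/lin/BA|exact/lin/BA].
have swap U V : C U -> C V ->
    b1 (b2 (U (V (b3 y)))) = b1 (e (U (e (V (b2 (b3 y)))))).
  move=> CU CV; have /= -> := Ann_Ann_commute_base B2 CU (V (b3 y)).
  by rewrite (mid_commute _ B2 CV.1 B3) (Be _ B1).
rewrite (swap T S) // (swap S T) //.
have := compressions_commute CT.1 CS.1 (b2 (b3 y)).
rewrite /= !(eB _ B2) !eK => ->; exact: subrr.
Qed.

End Commutative.
End DoubleAnnihilator.
End InnerProduct.

Theorem theorem18 (R : realType) (H : lmodType R[i]) (ip : H -> H -> R[i])
  (A : set (H -> H)) (e : H -> H) :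
  is_Hilbert ip ->
  is_Cstar_algebra ip A ->
  abelian_projection ip (weak_closure ip A) e ->
  A `&` corner e (weak_closure ip A) <> [set @op0 R H] ->
  is_Cstar_algebra ip (Ann A (Ann A (A `&` corner e (weak_closure ip A)))) /\
  commutative_set (Ann A (Ann A (A `&` corner e (weak_closure ip A)))).
Proof.
move=> [ipP _] AP [[_ ee esa] eMe] _.
set B := A `&` _.
have AM : A `<=` weak_closure ip A.
  move=> T AT; split; first by case: AP => + _ _ _; exact.
  move=> s r r0; exists T; split=> // p _.
  by rewrite subrr ip0l // normr0 ltcR.
have eK x : e (e x) = e x := congr1 (@^~ x) ee.
have eB x b : B b -> e (b x) = b x by case=> _ [T [_ ->]] /=; rewrite eK.
have Be x b : B b -> b (e x) = b x by case=> _ [T [_ ->]] /=; rewrite eK.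
have memB T : A T -> e \o T \o e =1 T -> B T.
  by move=> AT h; split=> //; exists T; split; [exact: AM | apply/funext].
have BA : B `<=` A by move=> T [].
have BP : star_closed ip B.
  have [Amul Aadj] := Cstar_star_closed AP; split.
    move=> T S BT BS; apply: memB; first by apply: Amul; exact: BA.
    by move=> x /=; rewrite eB // Be.
  move=> T BT; have [S [AS TS]] := Aadj T (BA _ BT).
  (* The adjoint stays in the corner because [e] is self-adjoint: [e S e] is the adjoint of
     [e T e = T]. *)
  exists S; split=> //; apply: memB => // x /=.
  apply: (ip_injl ipP) => y; rewrite esa (adjoint_sym ipP TS) esa.
  by rewrite eB // Be // (adjoint_sym ipP TS).
split; first exact: Ann_Ann_Cstar.
apply: (@Ann_Ann_commutative _ _ _ ipP _ _ AP BA BP e _ eK eB Be).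
move=> T S AT AS x.
(* The compression of [U] may leave [A], but it lies in the corner of the weak closure, which is
   commutative as [e] is Abelian. *)
have cornerM U : A U -> corner e (weak_closure ip A) (e \o U \o e).
  by move=> AU; exists U; split=> //; exact: AM.
by rewrite (eMe _ _ (cornerM T AT) (cornerM S AS)).
Qed.
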